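(* Let $x\in\mathbb{R}^3$, let $X$ be a real symmetric $3\times 3$ matrix and let $z\in\mathbb{R}$. Suppose that $(x,X,z)$ satisfies the linear constraints $$z\ge 0,\quad z\le X_{12},\quad z\le X_{13},\quad z\le X_{23},$$ $$X_{12}+X_{13}\le x_1+z,\quad X_{12}+X_{23}\le x_2+z,\quad X_{13}+X_{23}\le x_3+z,$$ $$x_1+x_2+x_3+z\le X_{12}+X_{13}+X_{23}+1,$$ together with the rotated second-order cone constraints $$z^2\le X_{11}X_{23},\quad z^2\le X_{22}X_{13},\quad z^2\le X_{33}X_{12}$$ and all of their switchings. Then $(x,X)$ satisfies all of the ETRI1 constraints and all of the ETRI2 constraints.
   Context: Rotated second-order cone constraints: a constraint $u^2\le vw$ of this kind is understood to include $v\ge 0$ and $w\ge 0$. Switching the variables in a set $S\subseteq\{1,2,3\}$ in a constraint in $(x,X,z)$ means making simultaneously the following substitutions: $x_p\mapsto 1-x_p$ for $p\in S$ and $x_p\mapsto x_p$ for $p\notin S$; $X_{pp}\mapsto 1-2x_p+X_{pp}$ for $p\in S$ and $X_{pp}\mapsto X_{pp}$ for $p\notin S$; for $p\ne q$: $X_{pq}\mapsto X_{pq}$ if $p,q\notin S$, $X_{pq}\mapsto x_q-X_{pq}$ if $p\in S$, $q\notin S$, and $X_{pq}\mapsto X_{pq}+1-x_p-x_q$ if $p,q\in S$; and $z\mapsto z$ if $S=\emptyset$, $z\mapsto X_{qr}-z$ if $S=\{p\}$ with $\{p,q,r\}=\{1,2,3\}$, $z\mapsto x_r-X_{pr}-X_{qr}+z$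 if $S=\{p,q\}$ with $\{p,q,r\}=\{1,2,3\}$, and $z\mapsto 1-x_1-x_2-x_3+X_{12}+X_{13}+X_{23}-z$ if $S=\{1,2,3\}$. (The variable $z$ is a proxy for $x_1x_2x_3$.) The switchings of a constraint are all constraints obtained from it in this way for subsets $S\subseteq\{1,2,3\}$. The ETRI1 constraints are the 24 inequalities consisting of $2x_1 + X_{11} - 2X_{12} - 2X_{13} + X_{23} \ge 0$, $2x_2 - 2X_{12} + X_{13} + X_{22} - 2X_{23} \ge 0$, $2x_3 + X_{12} - 2X_{13} - 2X_{23} + X_{33} \ge 0$ and their switchings. The ETRI2 constraints are the 24 inequalities consisting of $4x_1 + 4X_{11} - 4X_{12} - 4X_{13} + X_{23} \ge 0$, $4x_2 - 4X_{12} + X_{13} + 4X_{22} - 4X_{23} \ge 0$, $4x_3 + X_{12} - 4X_{13} - 4X_{23} + 4X_{33} \ge 0$ and their switchings. *)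

(* Defs.v *)
(* MathComp; the real numbers are an arbitrary [R : realType]. *)
From mathcomp Require Import all_boot all_order all_algebra.
From mathcomp Require Import reals.

Set Implicit Arguments.
Unset Strict Implicit.
Unset Printing Implicit Defensive.

Import Order.TTheory GRing.Theory Num.Theory.

Local Open Scope ring_scope.

Definition i1 : 'I_3 := @Ordinal 3 0 isT.
Definition i2 : 'I_3 := @Ordinal 3 1 isT.
Definition i3 : 'I_3 := @Ordinal 3 2 isT.

Definition constraint (R : realType) := 'cV[R]_3 -> 'M[R]_3 -> R -> Prop.

Definition switch_x (R : realType) (S : {set 'I_3}) (x : 'cV[R]_3) : 'cV[R]_3 :=
  \col_p (if p \in S then 1 - x p 0 else x p 0).

(* For p != q, X p q and X q p stand for the same variable of the symmetric
   matrix X, so the case p \notin S, q \in S is the case p \in S, q \notin S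
   with p and q exchanged. *)
Definition switch_X (R : realType) (S : {set 'I_3})
    (x : 'cV[R]_3) (X : 'M[R]_3) : 'M[R]_3 :=
  \matrix_(p, q)
    if p == q then
      (if p \in S then 1 - 2 * x p 0 + X p p else X p p)
    else
      match p \in S, q \in S with
      | false, false => X p q
      | true,  false => x q 0 - X p q
      | false, true  => x p 0 - X p q
      | true,  true  => X p q + 1 - x p 0 - x q 0
      end.

Definition switch_z (R : realType) (S : {set 'I_3})
    (x : 'cV[R]_3) (X : 'M[R]_3) (z : R) : R :=
  match i1 \in S, i2 \in S, i3 \in S with
  | false, false, false => z
  | true,  false, false => X i2 i3 - z
  | false, true,  false => X i1 i3 - z
  | false, false, true  => X i1 i2 - z
  | true,  true,  false => x i3 0 - X i1 i3 - X i2 i3 + z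
  | true,  false, true  => x i2 0 - X i1 i2 - X i2 i3 + z
  | false, true,  true  => x i1 0 - X i1 i2 - X i1 i3 + z
  | true,  true,  true  => 1 - x i1 0 - x i2 0 - x i3 0
                           + X i1 i2 + X i1 i3 + X i2 i3 - z
  end.

Definition switch (R : realType) (S : {set 'I_3}) (C : constraint R) :
    constraint R :=
  fun x X z => C (switch_x S x) (switch_X S x X) (switch_z S x X z).

(* The case S = set0 is C itself. *)
Definition all_switchings (R : realType) (C : constraint R) : constraint R :=
  fun x X z => forall S : {set 'I_3}, switch S C x X z.

Definition linear_constraints (R : realType) : constraint R :=
  fun x X z =>
    [/\ 0 <= z, z <= X i1 i2, z <= X i1 i3 & z <= X i2 i3] /\
    [/\ X i1 i2 + X i1 i3 <= x i1 0 + z,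
        X i1 i2 + X i2 i3 <= x i2 0 + z,
        X i1 i3 + X i2 i3 <= x i3 0 + z
      & x i1 0 + x i2 0 + x i3 0 + z <= X i1 i2 + X i1 i3 + X i2 i3 + 1].

Definition rotated_soc (R : realType) (u v w : R) : Prop :=
  [/\ u ^+ 2 <= v * w, 0 <= v & 0 <= w].

Definition rsoc_constraints (R : realType) : constraint R :=
  fun _ X z =>
    [/\ rotated_soc z (X i1 i1) (X i2 i3),
        rotated_soc z (X i2 i2) (X i1 i3)
      & rotated_soc z (X i3 i3) (X i1 i2)].

(* In [etri1] and [etri2] the variable z does not occur; switching x and X does
   not introduce it either. *)
Definition etri1 (R : realType) : constraint R :=
  fun x X _ =>
    [/\ 0 <= 2 * x i1 0 + X i1 i1 - 2 * X i1 i2 - 2 * X i1 i3 + X i2 i3,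
        0 <= 2 * x i2 0 - 2 * X i1 i2 + X i1 i3 + X i2 i2 - 2 * X i2 i3
      & 0 <= 2 * x i3 0 + X i1 i2 - 2 * X i1 i3 - 2 * X i2 i3 + X i3 i3].

Definition etri2 (R : realType) : constraint R :=
  fun x X _ =>
    [/\ 0 <= 4 * x i1 0 + 4 * X i1 i1 - 4 * X i1 i2 - 4 * X i1 i3 + X i2 i3,
        0 <= 4 * x i2 0 - 4 * X i1 i2 + X i1 i3 + 4 * X i2 i2 - 4 * X i2 i3
      & 0 <= 4 * x i3 0 + X i1 i2 - 4 * X i1 i3 - 4 * X i2 i3 + 4 * X i3 i3].

(* Main.v *)
Require Import Defs.
From mathcomp Require Import all_boot all_order all_algebra.
From mathcomp Require Import reals.
From mathcomp Require Import lra.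

Set Implicit Arguments.
Unset Strict Implicit.
Unset Printing Implicit Defensive.

Import Order.TTheory GRing.Theory Num.Theory.

Local Open Scope ring_scope.

(** The inequality [2 * x1 + X11 - 2 * X12 - 2 * X13 + X23 >= 0] is the sum of
    twice the linear constraint [X12 + X13 <= x1 + z] and of
    [2 * z <= X11 + X23], which the conic constraint [z ^ 2 <= X11 * X23] gives
    by the inequality of arithmetic and geometric means
    ([rotated_soc_double_le_add]).  For ETRI2 the linear constraint is taken
    four times and the means inequality is applied to the same product
    rebalanced as [(2 * z) ^ 2 <= (4 * X11) * X23].  Permuting the indices gives
    the other unswitched inequalities.

    The switched inequalities reduce to these.  The eight linear constraints say
    that the eight numbers that stand for the products of the [x p] or
    [1 - x p], one factor for each [p], are nonnegative; switching [S] exchanges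
    [x p] and [1 - x p] for [p] in [S], hence only permutes the eight numbers
    ([linear_constraints_switch]).  So the switched point again satisfies the
    linear and the unswitched conic constraints. *)

(** The sign conditions on [v] and [w] matter: they make [v + w] nonnegative, so
    that [(2 * u) ^ 2 <= 4 * (v * w) <= (v + w) ^ 2] can be unsquared. *)
Lemma rotated_soc_double_le_add (R : realType) (u v w : R) :
  rotated_soc u v w -> 2 * u <= v + w.
Proof.
case=> uvw v_ge0 w_ge0.
apply: le_trans (ler_norm _) _; rewrite -ler_sqr ?nnegrE ?addr_ge0 //.
rewrite -normrX ger0_norm ?sqr_ge0 // exprMn.
have := sqr_ge0 (v - w); lra.
Qed.

Lemma rotated_soc_rebalance (R : realType) (u v w : R) :
  rotated_soc u v w -> rotated_soc (2 * u) (4 * v) w.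
Proof. by case=> uvw v_ge0 w_ge0; split=> //; lra. Qed.

(** Whatever [S] is, each switched inequality becomes, once expanded, one of the
    eight original ones. *)
Lemma linear_constraints_switch (R : realType) (S : {set 'I_3})
    (x : 'cV[R]_3) (X : 'M[R]_3) (z : R) :
  linear_constraints x X z ->
  switch S (@linear_constraints R) x X z.
Proof.
case=> [[z0 z12 z13 z23] [le1 le2 le3 le123]].
rewrite /switch /linear_constraints /switch_z !mxE /=.
by case: (i1 \in S); case: (i2 \in S); case: (i3 \in S); split; split; lra.
Qed.

Lemma linear_rsoc_etri1 (R : realType)
    (x : 'cV[R]_3) (X : 'M[R]_3) (z : R) :
  linear_constraints x X z -> rsoc_constraints x X z -> etri1 x X z.
Proof.
move=> [_ [le1 le2 le3 _]] [soc1 soc2 soc3].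
have am1 := rotated_soc_double_le_add soc1.
have am2 := rotated_soc_double_le_add soc2.
have am3 := rotated_soc_double_le_add soc3.
by split; lra.
Qed.

Lemma linear_rsoc_etri2 (R : realType)
    (x : 'cV[R]_3) (X : 'M[R]_3) (z : R) :
  linear_constraints x X z -> rsoc_constraints x X z -> etri2 x X z.
Proof.
move=> [_ [le1 le2 le3 _]] [soc1 soc2 soc3].
have am1 := rotated_soc_double_le_add (rotated_soc_rebalance soc1).
have am2 := rotated_soc_double_le_add (rotated_soc_rebalance soc2).
have am3 := rotated_soc_double_le_add (rotated_soc_rebalance soc3).
by split; lra.
Qed.

Theorem lemma4 (R : realType) (x : 'cV[R]_3) (X : 'M[R]_3) (z : R)
    (X_sym : X^T = X)
    (lin : linear_constraints x X z)
    (rsoc : all_switchings (@rsoc_constraints R) x X z) :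
  all_switchings (@etri1 R) x X z /\ all_switchings (@etri2 R) x X z.
Proof.
split=> S.
- exact: linear_rsoc_etri1 (linear_constraints_switch S lin) (rsoc S).
- exact: linear_rsoc_etri2 (linear_constraints_switch S lin) (rsoc S).
Qed.
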